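(* Let $f\colon A \to B$ and $h\colon A \to C$ be two surjective functions between sets such that $\mathrm{Eq}(f) \circ \mathrm{Eq}(h) = \mathrm{Eq}(h) \circ \mathrm{Eq}(f)$. Let $F_g(f)\colon F_g(A) \to F_g(B)$ and $F_g(h)\colon F_g(A) \to F_g(C)$ be the induced group homomorphisms between free groups. Then $$\mathrm{Ker}(F_g(f)) \cap \mathrm{Ker}(F_g(h)) = \mathrm{K}_{\langle F_g(f), F_g(h)\rangle},$$ where $\mathrm{K}_{\langle F_g(f), F_g(h)\rangle} \subseteq F_g(A)$ is the set of $\langle F_g(f), F_g(h)\rangle$-symmetric paths with respect to the generating set $A \subseteq F_g(A)$.
   Context: For a set $A$, $F_g(A)$ denotes the free group on $A$, with $A$ regarded as a subset of $F_g(A)$ via the canonical inclusion of generators. A function $f\colon A\to B$ induces the group homomorphism $F_g(f)\colon F_g(A)\to F_g(B)$ sending the element represented by the word $a_1^{\delta_1}\cdots a_n^{\delta_n}$ (with $a_i\in A$, $\delta_i\in\{-1,1\}$) to the element represented by $f(a_1)^{\delta_1}\cdots f(a_n)^{\delta_n}$. $\mathrm{Ker}$ denotes the kernel of a group homomorphism. For a function $f\colon A\to B$, the kernel pair of $f$ is the equivalence relation $\mathrm{Eq}(f)=\{(a,b)\in A\times A \mid f(a)=f(b)\}$. For functions $f\colon A\to B$ and $h\colon A\to C$, the composite $\mathrm{Eq}(f)\circ\mathrm{Eq}(h)$ is the set of pairs $(a,b)\in A\times A$ for which there exists $c\in A$ with $(a,c)\in\mathrm{Eq}(f)$ and $(c,b)\in\mathrm{Eq}(h)$;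 $\mathrm{Eq}(h)\circ\mathrm{Eq}(f)$ is defined in the same way with the roles of $f$ and $h$ exchanged. Symmetric paths: let $\varphi\colon G\to H$ and $\psi\colon G\to K$ be group homomorphisms and let $A\subseteq G$ be a generating set of $G$. Four elements $g_a,g_b,g_c,g_d\in G$ are called $\langle \varphi,\psi\rangle$-symmetric (to each other), or a $\langle \varphi,\psi\rangle$-symmetric quadruple, with respect to $A$, if there exist $n\in\mathbb{N}$ (where $n=0$ is allowed), a sequence of quadruples $(a_1,b_1,c_1,d_1),\ldots,(a_n,b_n,c_n,d_n)$ in $A^4$, and exponents $\delta_1,\ldots,\delta_n\in\{-1,1\}$ such that for each $1\le i\le n$ $$\varphi(a_i)=\varphi(b_i),\quad \varphi(d_i)=\varphi(c_i),\quad \psi(a_i)=\psi(d_i),\quad \psi(b_i)=\psi(c_i),$$ and $$g_a=a_1^{\delta_1}\cdots a_n^{\delta_n},\quad g_b=b_1^{\delta_1}\cdots b_n^{\delta_n},\quad g_c=c_1^{\delta_1}\cdots c_n^{\delta_n},\quad g_d=d_1^{\delta_1}\cdots d_n^{\delta_n}.$$ The set $\mathrm{K}_{\langle \varphi,\psi\rangle}$ of $\langle \varphi,\psi\rangle$-symmetric paths (with respect to $A$) is the set of elements $g\in G$ such that $g=g_a g_b^{-1} g_c g_d^{-1}$ for some $\langle \varphi,\psi\rangle$-symmetric quadruple $g_a,g_b,g_c,g_d\in G$. *)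

(* Defs.v *)
From HB Require Import structures.
From mathcomp Require Import all_boot.
From mathcomp Require Import boolp classical_sets functions.
From Stdlib Require Import Relation_Operators.

Set Implicit Arguments.
Unset Strict Implicit.
Unset Printing Implicit Defensive.

Local Open Scope classical_set_scope.
Local Open Scope group_scope.
Local Open Scope quotient_scope.

(* [signed x true] is x^-1 and [signed x false] is x: a boolean sign stands   *)
(* for an exponent in {-1, 1}.                                                *)
Definition signed (G : groupType) (x : G) (s : bool) : G :=
  if s then x^-1 else x.

(* The free group on A: words in the signed letters (a, false) = a and        *)
(* (a, true) = a^-1, modulo the equivalence relation generated by cancelling  *)
(* two adjacent mutually inverse letters.                                     *)

Definition word (A : Type) := seq ({classic A} * bool).

Definition flip (A : Type) (l : {classic A} * bool) : {classic A} * bool :=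
  (l.1, ~~ l.2).

Inductive cancel1 (A : Type) : word A -> word A -> Prop :=
  Cancel1 u l v : cancel1 (u ++ [:: l, flip l & v]) (u ++ v).

Definition word_equiv (A : Type) : rel (word A) :=
  fun u v => `[< clos_refl_sym_trans (word A) (@cancel1 A) u v >].

Section FreeGroup.
Variable A : Type.
Implicit Types (u v w : word A) (l : {classic A} * bool).

Lemma word_equiv_refl : reflexive (@word_equiv A).
Proof. by move=> u; apply/asboolP/rst_refl. Qed.

Lemma word_equiv_sym : symmetric (@word_equiv A).
Proof.
by move=> u v; apply/idP/idP => /asboolP uv; apply/asboolP; apply: rst_sym.
Qed.

Lemma word_equiv_trans : transitive (@word_equiv A).
Proof.
by move=> v u w /asboolP uv /asboolP vw; apply/asboolP/(rst_trans _ _ _ v).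
Qed.

Canonical word_equiv_equivRel :=
  EquivRel (@word_equiv A) word_equiv_refl word_equiv_sym word_equiv_trans.

Definition free_group := {eq_quot (@word_equiv A)}.

HB.instance Definition _ := Choice.on free_group.
HB.instance Definition _ := Quotient.on free_group.
HB.instance Definition _ := EqQuotient.on free_group.

Definition word_inv u : word A := rev (map (@flip A) u).

Lemma free_groupP (x : free_group) : exists u, x = \pi_free_group u.
Proof. by exists (repr x); rewrite reprK. Qed.

Lemma free_group_eq u v :
  clos_refl_sym_trans _ (@cancel1 A) u v <->
  \pi_free_group u = \pi_free_group v.
Proof. by split=> [uv|/eqmodP/asboolP//]; apply/eqmodP/asboolP. Qed.

Lemma free_group_lift (T : Type) (F : word A -> T) :
    (forall u l v, F (u ++ [:: l, flip l & v]) = F (u ++ v)) ->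
  forall u v, u = v %[mod free_group] -> F u = F v.
Proof.
move=> FC u v /free_group_eq; elim=> {u v} // [_ _ [u l v]//|u v w _ -> _ ->//].
Qed.

Lemma pi_cancel u l v :
  \pi_free_group (u ++ [:: l, flip l & v]) = \pi_free_group (u ++ v).
Proof. by apply/free_group_eq/rst_step. Qed.

Lemma pi_cat u u' v v' : u = u' %[mod free_group] ->
  v = v' %[mod free_group] -> u ++ v = u' ++ v' %[mod free_group].
Proof.
move=> uu' vv'; transitivity (\pi_free_group (u' ++ v)).
- apply: (free_group_lift (F := fun w => \pi_free_group (w ++ v))) uu'.
  by move=> a l b; rewrite -!catA; apply: pi_cancel.
- apply: (free_group_lift (F := fun w => \pi_free_group (u' ++ w))) vv'.
  by move=> a l b; rewrite !catA; apply: pi_cancel.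
Qed.

Lemma flipK : involutive (@flip A).
Proof. by case=> a s; rewrite /flip/= negbK. Qed.

Lemma pi_inv u v : u = v %[mod free_group] ->
  word_inv u = word_inv v %[mod free_group].
Proof.
move: u v; apply: (free_group_lift (F := fun w => \pi_free_group (word_inv w))).
move=> u l v; rewrite /word_inv !map_cat !rev_cat /= !rev_cons -!cats1.
rewrite -!catA /=.
by rewrite flipK /=; apply: pi_cancel.
Qed.

Lemma word_invK : involutive word_inv.
Proof.
move=> u; rewrite /word_inv map_rev revK -map_comp map_id_in// => l _.
exact: flipK.
Qed.

Lemma pi_catV u : \pi_free_group (u ++ word_inv u) = \pi_free_group [::].
Proof.
elim: u => [|l u IH] //.
rewrite /word_inv /= rev_cons -cats1 catA -cat_cons -/(word_inv u).
transitivity (\pi_free_group ([:: l] ++ [::] ++ [:: flip l])).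
  by rewrite -cat1s -!catA !catA -[in LHS](catA [:: l]);
     apply: pi_cat => //; apply: pi_cat.
exact: (pi_cancel [::] l [::]).
Qed.

Definition free_one : free_group := \pi_free_group [::].
Definition free_mul (x y : free_group) : free_group :=
  \pi_free_group (repr x ++ repr y).
Definition free_inv (x : free_group) : free_group :=
  \pi_free_group (word_inv (repr x)).

Lemma free_mulE u v :
  free_mul (\pi_free_group u) (\pi_free_group v) =
  \pi_free_group (u ++ v).
Proof. by apply: pi_cat; rewrite reprK. Qed.

Lemma free_invE u : free_inv (\pi_free_group u) = \pi_free_group (word_inv u).
Proof. by apply: pi_inv; rewrite reprK. Qed.

Lemma free_mulA : associative free_mul.
Proof.
move=> x y z; have [[u ->] [v ->]] := (free_groupP x, free_groupP y).
have [w ->] := free_groupP z.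
by rewrite !free_mulE catA.
Qed.

Lemma free_mul1 : left_id free_one free_mul.
Proof. by move=> x; have [u ->] := free_groupP x; rewrite free_mulE. Qed.

Lemma free_mulr1 : right_id free_one free_mul.
Proof. by move=> x; have [u ->] := free_groupP x; rewrite free_mulE cats0. Qed.

Lemma free_mulV : right_inverse free_one free_inv free_mul.
Proof.
by move=> x; have [u ->] := free_groupP x; rewrite free_invE free_mulE pi_catV.
Qed.

Lemma free_mulVl : left_inverse free_one free_inv free_mul.
Proof.
move=> x; have [u ->] := free_groupP x.
rewrite free_invE free_mulE -[X in _ ++ X]word_invK.
exact: pi_catV.
Qed.

HB.instance Definition _ := isGroup.Build free_group
  free_mulA free_mul1 free_mulr1 free_mulVl free_mulV.

Definition free_gen (a : A) : free_group :=
  \pi_free_group [:: (a : {classic A}, false)].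

Lemma pi_word u :
  \pi_free_group u = \prod_(l <- u) signed (free_gen l.1) l.2.
Proof.
elim: u => [|[a s] u IH]; first by rewrite big_nil.
rewrite big_cons -IH -cat1s -free_mulE; congr (_ * _).
by case: s => //=; rewrite [_^-1]free_invE.
Qed.

End FreeGroup.

Section FreeMap.
Variables (A B : Type) (f : A -> B).

Definition word_map (u : word A) : word B :=
  [seq (f l.1 : {classic B}, l.2) | l <- u].

Definition free_map (x : free_group A) : free_group B :=
  \pi_(free_group B) (word_map (repr x)).

Lemma free_mapE (u : word A) :
  free_map (\pi_(free_group A) u) = \pi_(free_group B) (word_map u).
Proof.
apply: (free_group_lift (F := fun w => \pi_(free_group B) (word_map w))).
  by move=> a l b; rewrite /word_map !map_cat; apply: pi_cancel.
exact: reprK.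
Qed.

Lemma free_mapM : {morph free_map : x y / x * y}.
Proof.
move=> x y; have [[u ->] [v ->]] := (free_groupP x, free_groupP y).
rewrite [_ * _ in LHS]free_mulE !free_mapE [RHS]free_mulE.
by rewrite /word_map map_cat.
Qed.

Lemma free_map1 : free_map 1 = 1.
Proof. exact: free_mapE. Qed.

HB.instance Definition _ := isUMagmaMorphism.Build (free_group A)
  (free_group B) free_map (free_map1, free_mapM).

Lemma free_map_gen a : free_map (free_gen a) = free_gen (f a).
Proof. exact: free_mapE. Qed.

End FreeMap.

(* Multiplicative maps between groups automatically preserve 1 and inverses,  *)
(* so {multiplicative G -> H} is the type of group homomorphisms.             *)
Definition Ker (G H : groupType) (phi : {multiplicative G -> H}) : set G :=
  [set x | phi x = 1].

Definition Eq (A B : Type) (f : A -> B) : set (A * A) :=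
  [set p | f p.1 = f p.2].

(* [rel_comp R S] relates a to b when R a c and S c b for some c; the library *)
(* notation lists the relation applied first on the right.                    *)
Definition rel_comp (A : Type) (R S : set (A * A)) : set (A * A) :=
  (S \; R)%relation.

Definition is_subgroup (G : groupType) (S : set G) : Prop :=
  S 1 /\ (forall x y, S x -> S y -> S (x / y)).

Definition generates (G : groupType) (X : set G) : Prop :=
  forall S : set G, is_subgroup S -> X `<=` S -> S = setT.

Lemma free_gen_generates (A : Type) : generates (range (@free_gen A)).
Proof.
move=> S [S1 SF] XS; apply/seteqP; split=> // x _.
have SV y : S y -> S y^-1 by move=> Sy; rewrite -div1g; apply: SF.
have SM y z : S y -> S z -> S (y * z).
  by move=> Sy Sz; rewrite -[z]invgK; apply/SF/SV.
have [u ->] := free_groupP x; rewrite pi_word; apply: big_ind => // -[a s] _ /=.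
by case: s => /=; [apply: SV|]; apply: XS; exists a.
Qed.

Section SymmetricPaths.
Variables (G H K : groupType).
Variables (phi : {multiplicative G -> H}) (psi : {multiplicative G -> K}).
Variable X : set G.

Definition symmetric_quadruple (ga gb gc gd : G) : Prop :=
  exists (n : nat) (a b c d : 'I_n -> G) (delta : 'I_n -> bool),
    [/\ forall i, [/\ X (a i), X (b i), X (c i) & X (d i)],
        forall i, [/\ phi (a i) = phi (b i), phi (d i) = phi (c i),
                      psi (a i) = psi (d i) & psi (b i) = psi (c i)]
      & [/\ ga = \prod_(i < n) signed (a i) (delta i),
            gb = \prod_(i < n) signed (b i) (delta i),
            gc = \prod_(i < n) signed (c i) (delta i)
          & gd = \prod_(i < n) signed (d i) (delta i)]].

Definition symmetric_paths : set G :=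
  [set g | exists ga gb gc gd, symmetric_quadruple ga gb gc gd /\
                               g = ga * gb^-1 * gc * gd^-1].

End SymmetricPaths.

(* Main.v *)
Require Import Defs.
From HB Require Import structures.
From mathcomp Require Import all_boot.
From mathcomp Require Import boolp classical_sets functions.

(** Symmetric paths lie in both kernels: [phi] identifies the first two and the
    last two members of a symmetric quadruple, while [psi] identifies the outer
    two and the inner two, so the alternating product collapses.

    Conversely, let [x] lie in both kernels.  It suffices to find maps [e], [c],
    [d] from [A] to [A] such that every [(a, e a, c a, d a)] is a symmetric
    quadruple of generators, with [e] and [c] factoring through [f] and [d]
    through [h]: the last three induced endomorphisms then kill [x], and the
    quadruple obtained by applying these maps to the letters of [x] is
    [(x, 1, 1, 1)], whose alternating product is [x].

    Since [Eq f] and [Eq h] permute, their composite is an equivalence relation,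
    and a base point can be fixed in each of its classes.  Let [e] come from a
    section of [f].  The [f]-class of a base point meets every [h]-class lying
    in the same class of the composite: take [c a] there in the [h]-class of
    [e a], and [d a] there in the [h]-class of [a].  Both have the image of the
    base point under [f], and they can be chosen to depend only on [f a] and on
    [h a] respectively ([class_representative], [base_point]). *)

Local Open Scope classical_set_scope.
Local Open Scope group_scope.
Local Open Scope quotient_scope.

Section SymmetricPathsInKernel.
Variables (G H K : groupType).
Variables (phi : {multiplicative G -> H}) (psi : {multiplicative G -> K}).

(** A map of type [{multiplicative G -> L}] is only assumed to preserve products;
    between groups this forces it to preserve 1 and inverses. *)
Lemma multiplicative1 (L : groupType) (chi : {multiplicative G -> L}) :
  chi 1 = 1.
Proof. by apply: (mulgI (chi 1)); rewrite -gmulfM !mulg1. Qed.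

Lemma multiplicativeV (L : groupType) (chi : {multiplicative G -> L}) x :
  chi x^-1 = (chi x)^-1.
Proof.
by apply: (mulgI (chi x)); rewrite -gmulfM !mulgV multiplicative1.
Qed.

Lemma eq_morph_prod_signed (L : groupType) (chi : {multiplicative G -> L}) n
    (a b : 'I_n -> G) (s : 'I_n -> bool) :
  (forall i, chi (a i) = chi (b i)) ->
  chi (\prod_(i < n) signed (a i) (s i)) =
  chi (\prod_(i < n) signed (b i) (s i)).
Proof.
move=> ab; rewrite !(big_morph chi (gmulfM (s:=chi)) (multiplicative1 _ chi)).
by apply: eq_bigr => i _; case: (s i) => /=; rewrite ?multiplicativeV ab.
Qed.

Lemma symmetric_paths_sub_Ker (X : set G) :
  symmetric_paths phi psi X `<=` Ker phi `&` Ker psi.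
Proof.
move=> _ [_ [_ [_ [_ [[n [a [b [c [d [s [_ eqs [-> -> -> ->]]]]]]]] ->]]]]].
rewrite /Ker /=; split; rewrite !gmulfM !multiplicativeV.
- rewrite (eq_morph_prod_signed _ phi _ a b) => [|i]; last by case: (eqs i).
  rewrite (eq_morph_prod_signed _ phi _ d c) => [|i]; last by case: (eqs i).
  by rewrite mulgV mul1g mulgV.
- rewrite (eq_morph_prod_signed _ psi _ a d) => [|i]; last by case: (eqs i).
  rewrite (eq_morph_prod_signed _ psi _ b c) => [|i]; last by case: (eqs i).
  by rewrite mulgVK mulgV.
Qed.

End SymmetricPathsInKernel.

Section FreeMapWords.

Lemma free_map_word (A B : Type) (g : A -> B) (u : word A) :
  free_map g (\pi_(free_group A) u) =
  \prod_(i < size u) signed (free_gen (g (tnth (in_tuple u) i).1))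
                            (tnth (in_tuple u) i).2.
Proof. by rewrite free_mapE pi_word big_map big_tnth. Qed.

Lemma free_map_id (A : Type) (x : free_group A) : free_map id x = x.
Proof.
have [u ->] := free_groupP x; rewrite free_mapE; congr (\pi_(_) _).
by rewrite -[RHS]map_id; apply: eq_map => -[].
Qed.

Lemma free_map_comp1 (A B D : Type) (f : A -> B) (g : B -> D) x :
  free_map f x = 1 -> free_map (g \o f) x = 1.
Proof.
have [u ->] := free_groupP x => fu1.
rewrite -(free_map1 g) -fu1 !free_mapE; congr (\pi_(_) _).
by rewrite /word_map -map_comp.
Qed.

(** Letterwise application of four maps turns each element of the free group
    into a symmetric quadruple as soon as it does so on generators. *)
Lemma symmetric_quadruple_free_map (A B C : Type) (f : A -> B) (h : A -> C)
    (a b c d : A -> A) (x : free_group A) :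
    (forall z, [/\ f (a z) = f (b z), f (d z) = f (c z),
                   h (a z) = h (d z) & h (b z) = h (c z)]) ->
  symmetric_quadruple (free_map f) (free_map h) (range (@free_gen A))
    (free_map a x) (free_map b x) (free_map c x) (free_map d x).
Proof.
move=> abcd; have [u ->] := free_groupP x.
pose letter (i : 'I_(size u)) : A := (tnth (in_tuple u) i).1.
pose gen (g : A -> A) i := free_gen (g (letter i)).
exists (size u), (gen a), (gen b), (gen c), (gen d).
exists (fun i => (tnth (in_tuple u) i).2).
split; last by rewrite !free_map_word.
- by move=> i; split; apply: imageT.
- move=> i; have [ab dc ad bc] := abcd (letter i).
  by split; rewrite [LHS]free_map_gen [RHS]free_map_gen ?ab ?dc ?ad ?bc.
Qed.

End FreeMapWords.

Section BasePoints.

(** A choice of one representative in each class of an equivalence relation. *)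
Lemma class_representative (T : Type) (R : T -> T -> Prop) :
    (forall a, R a a) -> (forall a b, R a b -> R b a) ->
    (forall a b c, R a b -> R b c -> R a c) ->
  exists r : T -> T, (forall a, R a (r a)) /\ (forall a b, R a b -> r a = r b).
Proof.
move=> Rrefl Rsym Rtrans.
pose pick (S : set T) (S0 : exists a, S a) := projT1 (cid S0).
exists (fun a => pick (R a) (ex_intro (R a) a (Rrefl a))); split=> [a|a b Rab].
  exact: projT2 (cid _).
have RE : R a = R b.
  apply/funext => c; apply/propext; split; last exact: Rtrans.
  by apply: Rtrans; apply: Rsym.
move: (ex_intro _ a _) (ex_intro _ b _); rewrite RE => p q.
by rewrite (Prop_irrelevance p q).
Qed.

Variables (A B C : Type) (f : A -> B) (h : A -> C).
Hypothesis fh_perm : rel_comp (Eq f) (Eq h) = rel_comp (Eq h) (Eq f).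

Lemma Eq_permute a b :
  (exists2 c, f a = f c & h c = h b) <-> (exists2 c, h a = h c & f c = f b).
Proof.
have /(congr1 (@^~ (a, b))) := fh_perm.
by rewrite /rel_comp /Eq /= => ->.
Qed.

(** [r a] is the base point of the class of [a] under the composite of the two
    kernel pairs.  As it is constant on [f]-classes and on [h]-classes, it can
    be computed from [f a] alone or from [h a] alone. *)
Lemma base_point : exists r : A -> A,
  [/\ forall a b, f a = f b -> r a = r b, forall a b, h a = h b -> r a = r b
    & forall a, exists2 c, h c = h a & f c = f (r a)].
Proof.
pose R a b := exists2 c, f a = f c & h c = h b.
have Rsym a b : R a b -> R b a.
  by move=> [c ac cb]; apply/Eq_permute; exists c.
have Rtrans a b c : R a b -> R b c -> R a c.
  move=> [x ax xb] [y b_y yc].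
  have /Eq_permute [z xz zy] : exists2 z, h x = h z & f z = f y by exists b.
  by exists z; [rewrite ax | rewrite zy].
have [a|r [Rr rR]] := class_representative A R _ Rsym Rtrans; first by exists a.
exists r; split=> [a b ab|a b ab|a].
- by apply: rR; exists b.
- by apply: rR; exists a.
- by have /Eq_permute [c ac cr] := Rr a; exists c.
Qed.

End BasePoints.

Theorem theorem2p10 (A B C : Type) (f : A -> B) (h : A -> C)
    (f_surj : set_surj [set: A] [set: B] f) (h_surj : set_surj [set: A] [set: C] h)
    (fh_perm : rel_comp (Eq f) (Eq h) = rel_comp (Eq h) (Eq f)) :
  Ker (free_map f) `&` Ker (free_map h) =
    symmetric_paths (free_map f) (free_map h) (range (@free_gen A)).
Proof.
apply/seteqP; split; last exact: symmetric_paths_sub_Ker.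
move=> x [/= fx1 hx1].
have [r [rf rh rP]] := base_point _ _ _ f h fh_perm.
have /choice [s sK] b : exists a, f a = b by have [a _ <-] := f_surj b I; exists a.
have /choice [t tK] y : exists a, h a = y by have [a _ <-] := h_surj y I; exists a.
(* [p a] is in the [h]-class of [a] and the [f]-class of the base point *)
have /choice [p pP] a : exists c, h c = h a /\ f c = f (r a).
  by have [c] := rP a; exists c.
exists (free_map id x), (free_map (s \o f) x).
exists (free_map ((p \o s) \o f) x), (free_map ((p \o t) \o h) x); split.
- apply: symmetric_quadruple_free_map => a /=.
  have [hps fps] := pP (s (f a)); have [hpt fpt] := pP (t (h a)).
  split=> //; last by rewrite hpt tK.
  by rewrite fps fpt; congr f; rewrite (rh _ a) ?tK// (rf _ a) ?sK.
- have e1 := free_map_comp1 _ _ _ f s x fx1.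
  have c1 := free_map_comp1 _ _ _ f (p \o s) x fx1.
  have d1 := free_map_comp1 _ _ _ h (p \o t) x hx1.
  by rewrite free_map_id e1 c1 d1 !divg1 mulg1.
Qed.
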